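(* In the setting described in the context, the sequence $(u_m)_{m\ge0}$ is almost surely not eventually constant. Moreover, for every realization in which $(u_m)_{m\ge0}$ is not eventually constant, the sequence $(z_m)_{m\ge0}$ converges in $\overline{\mathbb{H}}$ to some point $\zeta\in\overline{\mathbb{R}}$.
   Context: Let $\mathbb{H}=\{z\in\mathbb{C}:\operatorname{Im}z>0\}$ be the Poincaré upper half-plane (metric $(dx^2+dy^2)/y^2$), $\overline{\mathbb{R}}=\mathbb{R}\cup\{\infty\}$, and $\overline{\mathbb{H}}=\mathbb{H}\cup\overline{\mathbb{R}}$ (a closed disk). A (hyperbolic) line is a set $\{z\in\mathbb{H}:\operatorname{Re}z=x\}$ or $\{z\in\mathbb{H}:|z-x|=r\}$ with $x\in\mathbb{R}$, $r>0$; its reflection $t_L$ is $t_L(z)=2x-\bar z$, resp. $t_L(z)=r^2/(\bar z-x)+x$, extended continuously to $\overline{\mathbb{H}}$. Fix lines $L_1,L_2,L_3\subseteq\mathbb{H}$ and $z_0\in\mathbb{H}$ such that for all distinct $i,i'\in\{1,2,3\}$ either (a) $L_i\cap L_{i'}=\emptyset$ and $z_0$ lies in the connected component of $\mathbb{H}\setminus(L_i\cup L_{i'})$ whose boundary contains both lines, or (b) $L_i,L_{i'}$ meet at an angle of measure $\pi/m(i,i')$ with $m(i,i')\ge2$ an integer, and $z_0$ lies in the interior of that angle. Let $s_i=t_{L_i}$, let $W$ be the group generated by $S=\{s_1,s_2,s_3\}$ (a Coxeter system; $W$ is infinite and acts properly on $\mathbb{H}$), and let $\ell$ be the word length with respect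 to $S$. Let $i_1,i_2,\ldots$ be independent uniform random elements of $\{1,2,3\}$. Define $u_0=1$ and $u_{m+1}=u_m s_{i_{m+1}}$ if $\ell(u_ms_{i_{m+1}})>\ell(u_m)$, and $u_{m+1}=u_m$ otherwise (this is $u_m=s_{i_1}\star\cdots\star s_{i_m}$ for the Demazure product $\star$), and set $z_m=u_m(z_0)$. *)

(* Defs.v *)
From HB Require Import structures.
From mathcomp Require Import all_boot all_order all_algebra.
From mathcomp Require Import all_classical all_reals all_analysis.
Set Implicit Arguments. Unset Strict Implicit. Unset Printing Implicit Defensive.
Import Order.TTheory GRing.Theory Num.Theory.
Import numFieldNormedType.Exports.
Local Open Scope classical_set_scope.
Local Open Scope ring_scope.

Section Hyp.
Variable R : realType.

(* Points of the upper half-plane are pairs (x, y) = x + i y with y > 0. *)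
Definition pt := (R * R)%type.
Definition inH (z : pt) : Prop := 0 < z.2.

(* Hyperbolic lines: Vert x = {Re z = x}, Circ x r = {|z - x| = r}. *)
Inductive hline := Vert of R | Circ of R & R.

Definition line_ok (L : hline) : Prop :=
  match L with Vert _ => True | Circ _ r => 0 < r end.

(* Defining function of the line: L = {z in H | lfun L z = 0};
   its two sides are {lfun L > 0} and {lfun L < 0}. *)
Definition lfun (L : hline) (z : pt) : R :=
  match L with
  | Vert a => z.1 - a
  | Circ a r => (z.1 - a) ^+ 2 + z.2 ^+ 2 - r ^+ 2
  end.

Definition lgrad (L : hline) (z : pt) : pt :=
  match L with
  | Vert _ => (1, 0)
  | Circ a _ => (2 * (z.1 - a), 2 * z.2)
  end.

Definition on_line (L : hline) (z : pt) : Prop := inH z /\ lfun L z = 0.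

(* The reflection t_L: t(z) = 2x - conj z, resp. r^2/(conj z - x) + x. *)
Definition refl (L : hline) (z : pt) : pt :=
  match L with
  | Vert a => (2 * a - z.1, z.2)
  | Circ a r =>
      let d := (z.1 - a) ^+ 2 + z.2 ^+ 2 in
      (a + r ^+ 2 * (z.1 - a) / d, r ^+ 2 * z.2 / d)
  end.

Definition dotp (u v : pt) : R := u.1 * v.1 + u.2 * v.2.
Definition enorm (u : pt) : R := Num.sqrt (dotp u u).

(* Condition (a): the lines are disjoint and z0 lies in the component of
   H \ (L u L') whose boundary contains both lines, i.e. on the side of L
   containing L' and on the side of L' containing L. *)
Definition cond_disjoint (L L' : hline) (z0 : pt) : Prop :=
  ~ (exists p, on_line L p /\ on_line L' p) /\
  (forall p, on_line L' p -> 0 < lfun L z0 * lfun L p) /\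
  (forall p, on_line L p -> 0 < lfun L' z0 * lfun L' p).

(* Condition (b): L and L' meet (at p) at an angle of measure pi/m, m >= 2,
   and z0 lies in the interior of that angle: z0 lies off both lines, and the
   open sector {sign lfun L = eps} /\ {sign lfun L' = eps'} containing z0 has
   (Euclidean = hyperbolic, by conformality) opening angle pi/m at p.  The
   opening angle theta of the sector bounded by half-planes with inward normals
   n, n' satisfies cos theta = - <n, n'> / (|n| |n'|), with n = eps * lgrad. *)
Definition cond_angle (L L' : hline) (z0 : pt) : Prop :=
  exists (m : nat) (p : pt), (2 <= m)%N /\ on_line L p /\ on_line L' p /\
    lfun L z0 != 0 /\ lfun L' z0 != 0 /\
    Num.sg (lfun L z0 * lfun L' z0) * dotp (lgrad L p) (lgrad L' p)
      = - (enorm (lgrad L p) * enorm (lgrad L' p)) * cos (pi / m%:R).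

(* Words in the generators s_0, s_1, s_2 (indices shifted to 'I_3).
   The word [:: j1; ...; jk] represents s_j1 * ... * s_jk, acting on H by
   z |-> s_j1 (s_j2 (... (s_jk z))). *)
Definition act (L : 'I_3 -> hline) (w : seq 'I_3) (z : pt) : pt :=
  foldr (fun j acc => refl (L j) acc) z w.

(* Two words represent the same element of W (W acts faithfully on H). *)
Definition word_eq (L : 'I_3 -> hline) (w w' : seq 'I_3) : Prop :=
  forall z, inH z -> act L w z = act L w' z.

Lemma word_len_ex (L : 'I_3 -> hline) (w : seq 'I_3) :
  exists n, `[< exists w', word_eq L w w' /\ size w' = n >].
Proof. by exists (size w); apply/asboolP; exists w. Qed.

Definition ell (L : 'I_3 -> hline) (w : seq 'I_3) : nat := ex_minn (word_len_ex L w).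

(* u_0 = 1, u_{m+1} = u_m s_{i_{m+1}} if ell increases, else u_m.
   Here idx m plays the role of i_{m+1}. *)
Fixpoint demazure (L : 'I_3 -> hline) (idx : nat -> 'I_3) (m : nat) : seq 'I_3 :=
  match m with
  | 0 => [::]
  | m'.+1 =>
      let u := demazure L idx m' in
      if (ell L u < ell L (rcons u (idx m')))%N then rcons u (idx m') else u
  end.

Definition eventually_const (L : 'I_3 -> hline) (u : nat -> seq 'I_3) : Prop :=
  exists N, forall m, (N <= m)%N -> word_eq L (u m) (u N).

(* Convergence in the closed disk H u R u {oo} to a boundary point:
   Some a = the real point a, None = oo. *)
Definition conv_bdry (z : nat -> pt) (zeta : option R) : Prop :=
  match zeta with
  | Some a => ((fun m => (z m).1) @ \oo --> a) /\ ((fun m => (z m).2) @ \oo --> 0)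
  | None => forall M : R, \forall m \near \oo, M < (z m).1 ^+ 2 + (z m).2 ^+ 2
  end.

End Hyp.

(* Main.v *)
Require Import Defs.
From HB Require Import structures.
From mathcomp Require Import all_boot all_order all_algebra.
From mathcomp Require Import all_classical all_reals all_analysis.
From mathcomp Require Import ring lra zify.
Import Order.TTheory GRing.Theory Num.Theory.
Import numFieldNormedType.Exports.
Local Open Scope classical_set_scope.
Local Open Scope ring_scope.

Set Implicit Arguments. Unset Strict Implicit. Unset Printing Implicit Defensive.

(* In the hyperboloid model let [e i] be the unit normal of [L i] pointing to
   the side of [z0]; then [<e i, e j>] is [-cos (pi / m)] or at most [-1].

   As in Tits' theorem on the geometric representation, [l(w s_i) >= l(w)]
   implies [<e i, w^-1 z0> > 0]. If the process stopped at [u] although all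
   letters recur, [u^-1 z0] would lie on the negative side of all three lines.
   This is impossible: the Gram matrix of the normals has nonpositive entries
   off the diagonal and is not positive definite, so some nonnegative
   combination of the normals is timelike or null, and the products of such a
   vector with the points of the half-plane all have the same sign.

   Let [z_m = u_m z0]. Each letter of a reduced word reflects away from [z0], so
   [d(z_m, z_n) <= d(z0, z_n)] for [m <= n]; moreover distinct points of the
   sequence are uniformly separated, so [z_m] leaves every compact set. In the
   Klein disk the first fact bounds [|z_m - z_n|^2] by a constant over the time
   coordinate of [z_m], hence the sequence is Cauchy, and its limit lies on the
   boundary. *)

Lemma exists_linear_dependency (K : fieldType) (V : vectType K) n
    (e : 'I_n -> V) (v : V) : (\dim {:V} <= n)%N ->
  exists (x : 'I_n -> K) (y : K), \sum_i x i *: e i = y *: v /\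
    ((exists i, x i != 0) \/ y != 0).
Proof.
move=> dim_le; pose t := [tuple oapp e v (unlift ord0 i) | i < n.+1].
have : ~~ free t.
  apply: contraL dim_le => /eqP free_t; rewrite -ltnNge.
  by rewrite -[n.+1](size_tuple t) -free_t dimvS ?subvf.
move/freeP => not_free.
have /existsNP[k /not_implyP[k0 /existsNP[j /eqP kj]]] := not_free.
exists (fun i => k (lift ord0 i)), (- k ord0); split.
  apply/eqP; rewrite scaleNr -addr_eq0 addrC -[X in _ == X]k0.
  rewrite big_ord_recl; apply/eqP; congr (_ + _).
    by rewrite -tnth_nth tnth_mktuple unlift_none.
  by apply: eq_bigr => i _; rewrite -tnth_nth tnth_mktuple liftK.
case: (unliftP ord0 j) kj => [i ->|->] kj; last by right; rewrite oppr_eq0.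
by left; exists i.
Qed.

Section LorentzForm.
Variable R : realType.
Implicit Types (u v w : 'rV[R]_3).

Definition vec3 (a b c : R) : 'rV[R]_3 := \row_j [:: a; b; c]`_j.

(* [(a, b, c)] stands for the symmetric matrix with rows [(a, b)] and [(b, c)]:
   the quadratic form is minus the determinant. *)
Definition lform v w : R :=
  v 0 1 * w 0 1 - (v 0 0 * w 0 2 + v 0 2 * w 0 0) / 2.

Lemma exists_vec3 v : exists a b c, v = vec3 a b c.
Proof.
exists (v 0 0), (v 0 1), (v 0 2); apply/rowP => j; rewrite mxE.
by case: j => -[|[|[|//]]] lt_j /=; congr (v 0 _); apply: val_inj.
Qed.

Lemma lform_vec3 a b c a' b' c' :
  lform (vec3 a b c) (vec3 a' b' c') = b * b' - (a * c' + c * a') / 2.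
Proof. by rewrite /lform !mxE. Qed.

Lemma lform_is_bilinear : bilinear_for
  (GRing.Scale.Law.clone _ _ *%R _) (GRing.Scale.Law.clone _ _ *%R _) lform.
Proof. by split=> [u|u] a x y; rewrite /lform !mxE /=; ring. Qed.

HB.instance Definition _ := bilinear_isBilinear.Build R
  'rV[R]_3 'rV[R]_3 R _ _ lform lform_is_bilinear.

Lemma lformDl u v w : lform (u + v) w = lform u w + lform v w.
Proof. exact: linearDl. Qed.

Lemma lformDr u v w : lform u (v + w) = lform u v + lform u w.
Proof. exact: linearDr. Qed.

Lemma lformNl v w : lform (- v) w = - lform v w.
Proof. exact: linearNl. Qed.

Lemma lformNr v w : lform v (- w) = - lform v w.
Proof. exact: linearNr. Qed.

Lemma lformZl c v w : lform (c *: v) w = c * lform v w.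
Proof. exact: linearZl_LR. Qed.

Lemma lformZr c v w : lform v (c *: w) = c * lform v w.
Proof. exact: linearZr_LR. Qed.

Definition lformE := (lformDl, lformDr, lformNl, lformNr, lformZl, lformZr).

Lemma lformC v w : lform v w = lform w v.
Proof. by rewrite /lform; ring. Qed.

Lemma lform_suml n (x : 'I_n -> R) (e : 'I_n -> 'rV[R]_3) v :
  lform (\sum_i x i *: e i) v = \sum_i x i * lform (e i) v.
Proof. by rewrite linear_sumlz /=; apply: eq_bigr => i _; rewrite lformZl. Qed.

Lemma lform_gram_det_le0 u v w :
  lform u u * (lform v v * lform w w - lform v w ^+ 2)
  - lform u v * (lform u v * lform w w - lform v w * lform u w)
  + lform u w * (lform u v * lform v w - lform v v * lform u w) <= 0.
Proof.
have [a [b [c ->]]] := exists_vec3 u; have [a' [b' [c' ->]]] := exists_vec3 v.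
have [a'' [b'' [c'' ->]]] := exists_vec3 w; rewrite !lform_vec3.
rewrite -oppr_ge0; apply: le_trans (sqr_ge0 ((a * (b' * c'' - c' * b'')
  - b * (a' * c'' - c' * a'') + c * (a' * b'' - b' * a'')) / 2)) _.
by rewrite le_eqVlt; apply/orP; left; apply/eqP; field.
Qed.

(* Taking absolute values of the coefficients of a combination of the [e i]
   that is proportional to [v] can only decrease its square. *)
Lemma obtuse_family_causal_comb n (e : 'I_n -> 'rV[R]_3) v : (2 < n)%N ->
  (forall i j, i != j -> lform (e i) (e j) <= 0) -> lform v v < 0 ->
  exists x : 'I_n -> R, [/\ forall i, 0 <= x i, exists i, 0 < x i &
    lform (\sum_i x i *: e i) (\sum_i x i *: e i) <= 0].
Proof.
move=> n3 obtuse v0; have [|x [y [xyE xy0]]] := exists_linear_dependency e v.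
  by rewrite dimvf.
have lform_comb (c : 'I_n -> R) : lform (\sum_i c i *: e i) (\sum_i c i *: e i)
    = \sum_i \sum_j c i * c j * lform (e i) (e j).
  rewrite lform_suml; apply: eq_bigr => i _.
  rewrite lformC lform_suml mulr_sumr; apply: eq_bigr => j _.
  by rewrite lformC mulrA.
exists (fun i => `|x i|); split=> //.
- case: xy0 => [[i xi]|y0]; first by exists i; rewrite normr_gt0.
  apply: contrapT => /forallNP x0; move: xyE; rewrite big1 => [/esym/eqP|i _].
    rewrite scaler_eq0 (negbTE y0) /= => /eqP vE.
    by move: v0; rewrite vE linear0l ltxx.
  by have /negP := x0 i; rewrite normr_gt0 negbK => /eqP ->; rewrite scale0r.
- apply: (@le_trans _ _ (lform (y *: v) (y *: v))).
    rewrite -xyE !lform_comb; apply: ler_sum => i _; apply: ler_sum => j _.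
    have [->|ij] := eqVneq i j.
      by rewrite -normrM ger0_norm // -expr2 sqr_ge0.
    by rewrite ler_wnM2r ?obtuse // -normrM ler_norm.
  by rewrite lformZl lformZr mulrA -expr2 mulr_ge0_le0 ?sqr_ge0 // ltW.
Qed.

End LorentzForm.

Section Hyperboloid.
Variable R : realType.
Implicit Types (z : pt R) (L : hline R) (v n : 'rV[R]_3).

Definition emb z : 'rV[R]_3 :=
  vec3 z.2^-1 (z.1 / z.2) ((z.1 ^+ 2 + z.2 ^+ 2) / z.2).

(* The hyperbolic cosine of the distance. *)
Definition coshd z z' : R := - lform (emb z) (emb z').

Lemma inH_neq0 z : inH z -> z.2 != 0.
Proof. exact: lt0r_neq0. Qed.

Lemma sqnorm_gt0 (x y : R) : 0 < y -> 0 < x ^+ 2 + y ^+ 2.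
Proof. by move=> y0; rewrite ltr_wpDl ?sqr_ge0 ?exprn_gt0. Qed.

Lemma emb_norm z : inH z -> lform (emb z) (emb z) = -1.
Proof. by move=> /inH_neq0 y0; rewrite lform_vec3; field. Qed.

Lemma emb_inj : {in [pred z | 0 < z.2] &, injective emb}.
Proof.
move=> [x y] [x' y']; rewrite !inE /= => _ /lt0r_neq0 y'0 /rowP eq_emb.
have := eq_emb 0; rewrite !mxE /= => /invr_inj yE.
by have := eq_emb 1; rewrite !mxE /= yE => /(mulIf (invr_neq0 y'0)) ->.
Qed.

Lemma coshdE z z' : inH z -> inH z' ->
  coshd z z' = 1 + ((z.1 - z'.1) ^+ 2 + (z.2 - z'.2) ^+ 2) / (2 * z.2 * z'.2).
Proof.
move=> /inH_neq0 y0 /inH_neq0 y'0; rewrite /coshd lform_vec3.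
by field; rewrite y0 y'0.
Qed.

Lemma coshdC z z' : coshd z z' = coshd z' z.
Proof. by rewrite /coshd lformC. Qed.

Lemma coshd_ge1 z z' : inH z -> inH z' -> 1 <= coshd z z'.
Proof.
move=> hz hz'; rewrite coshdE // lerDl divr_ge0 //.
  by rewrite addr_ge0 ?sqr_ge0.
by rewrite !mulr_ge0 // ltW.
Qed.

Lemma lform_emb_gram_le v z z' : inH z -> inH z' ->
  lform v (emb z) ^+ 2 + lform v (emb z') ^+ 2
  <= 2 * lform v (emb z) * lform v (emb z') * coshd z z'
     + lform v v * (coshd z z' ^+ 2 - 1).
Proof.
move=> hz hz'; have := lform_gram_det_le0 v (emb z) (emb z').
by rewrite !emb_norm // /coshd; lra.
Qed.

(* [cosh (a + b) <= 2 cosh a cosh b] *)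
Lemma coshd_triangle z z' z'' : inH z -> inH z' -> inH z'' ->
  coshd z z'' <= 2 * coshd z z' * coshd z' z''.
Proof.
move=> hz hz' hz''; have zz'_ge1 := coshd_ge1 hz hz'.
rewrite -(ler_pM2l (lt_le_trans ltr01 (coshd_ge1 hz hz''))).
have := lform_emb_gram_le (emb z) hz' hz''; rewrite emb_norm //.
rewrite -[lform _ (emb z')]opprK -[lform _ (emb z'')]opprK.
rewrite -/(coshd z z') -/(coshd z z'').
by have := exprn_ege1 2 zz'_ge1; have := sqr_ge0 (coshd z' z''); lra.
Qed.

Lemma causal_lform_gt0 v z z' : lform v v <= 0 -> inH z -> inH z' ->
  0 < lform v (emb z) -> 0 < lform v (emb z').
Proof.
move=> v0 hz hz' vz; rewrite ltNge; apply/negP => vz'.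
have := lform_emb_gram_le v hz hz'; have := coshd_ge1 hz hz'.
have : lform v v * (coshd z z' ^+ 2 - 1) <= 0.
  by rewrite mulr_le0_ge0 // subr_ge0 exprn_ege1 // coshd_ge1.
move: vz vz'; move: (lform v (emb z)) (lform v (emb z')) (coshd z z').
move=> a b c a_gt0 b_le0 c_ge1 q_le0.
have := sqr_ge0 b; have := exprn_gt0 2 a_gt0.
have : a * b * c <= 0 by rewrite mulr_le0_ge0 ?(le_trans ler01) ?pmulr_rle0.
by lra.
Qed.

Lemma coshd_sqr_ge_opposite v z z' : lform v v = 1 -> inH z -> inH z' ->
  lform v (emb z) * lform v (emb z') <= 0 ->
  1 + lform v (emb z) ^+ 2 <= coshd z z' ^+ 2.
Proof.
move=> v1 hz hz'; have := lform_emb_gram_le v hz hz'; have := coshd_ge1 hz hz'.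
rewrite v1; move: (lform v (emb z)) (lform v (emb z')) (coshd z z') => a b c.
move=> c_ge1 gram ab_le0.
have : a * b * c <= 0 by rewrite mulr_le0_ge0 ?(le_trans ler01).
by have := sqr_ge0 b; lra.
Qed.

Lemma timelike_emb v z0 : lform v v < 0 -> inH z0 -> lform v (emb z0) < 0 ->
  exists2 z, inH z & exists2 c, 0 < c & v = c *: emb z.
Proof.
have [a [b [c ->]]] := exists_vec3 v; case: z0 => [x y].
rewrite /inH !lform_vec3 /= => det0 y0 vz0.
have a_gt0 : 0 < a.
  have quad_gt0 : 0 < a * (x ^+ 2 + y ^+ 2) - 2 * b * x + c.
    have := vz0; rewrite -(pmulr_rlt0 _ y0) -oppr_gt0.
    suff -> : a * (x ^+ 2 + y ^+ 2) - 2 * b * x + c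
      = 2 * - (y * (b * (x / y) - (a * ((x ^+ 2 + y ^+ 2) / y) + c / y) / 2)).
      by rewrite pmulr_rgt0.
    by field; exact: lt0r_neq0.
  rewrite -(pmulr_lgt0 _ quad_gt0).
  by have := sqr_ge0 (a * x - b); have := sqr_ge0 (a * y); lra.
pose s := Num.sqrt (a * c - b ^+ 2).
have s_gt0 : 0 < s by rewrite sqrtr_gt0; lra.
have sE : s ^+ 2 = a * c - b ^+ 2 by rewrite sqr_sqrtr //; lra.
exists (b / a, s / a); first exact: divr_gt0.
exists s => //; apply/rowP => j; rewrite !mxE !expr_div_n sE.
by case: j => -[|[|[|//]]] ? /=; field;
  rewrite ?(lt0r_neq0 a_gt0) (lt0r_neq0 s_gt0).
Qed.

Lemma orthogonal_residue_emb n z : inH z -> 0 <= lform n n ->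
  lform n (emb z) = lform n n ->
  exists2 p, inH p & exists2 c, 0 < c & emb z - n = c *: emb p.
Proof.
move=> hz n0 nz; have zn : lform (emb z) n = lform n n by rewrite lformC.
apply: (@timelike_emb _ z) => //.
  by rewrite !lformE emb_norm // nz zn; lra.
by rewrite !lformE emb_norm // nz; lra.
Qed.

Definition lnormal L : 'rV[R]_3 :=
  match L with
  | Vert a => vec3 0 1 (2 * a)
  | Circ a r => vec3 (- r^-1) (- (a / r)) (- ((a ^+ 2 - r ^+ 2) / r))
  end.

Definition lscale L : R := match L with Vert _ => 1 | Circ _ r => 2 * r end.

Lemma lscale_gt0 L : line_ok L -> 0 < lscale L.
Proof. by case: L => [a|a r] //= r0; rewrite mulr_gt0. Qed.

Lemma lnormal_norm L : line_ok L -> lform (lnormal L) (lnormal L) = 1.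
Proof.
case: L => [a|a r] /=; rewrite lform_vec3; first by move=> _; lra.
by move=> /lt0r_neq0 r0; field.
Qed.

Lemma lfunE L z : line_ok L -> inH z ->
  lfun L z = lscale L * z.2 * lform (lnormal L) (emb z).
Proof.
case: L => [a|a r] /=; rewrite lform_vec3.
  by move=> _ /inH_neq0 y0; field.
by move=> /lt0r_neq0 r0 /inH_neq0 y0; field; rewrite y0 r0.
Qed.

Lemma inH_refl L z : line_ok L -> inH z -> inH (refl L z).
Proof.
rewrite /inH; case: L => [a|a r] //= r0 y0.
by rewrite divr_gt0 ?sqnorm_gt0 // mulr_gt0 ?exprn_gt0.
Qed.

Lemma emb_refl L z : line_ok L -> inH z ->
  emb (refl L z) = emb z - (2 * lform (lnormal L) (emb z)) *: lnormal L.
Proof.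
move=> ok hz; apply/rowP => j; move: ok; case: L => [a|a r] /=.
  move=> _; rewrite lform_vec3 !mxE; move/inH_neq0: hz => y0.
  by case: j => -[|[|[|//]]] ? /=; field.
move=> /lt0r_neq0 r0; rewrite lform_vec3 !mxE.
have /lt0r_neq0 d0 := sqnorm_gt0 (z.1 - a) hz; move/inH_neq0: hz => y0.
by case: j => -[|[|[|//]]] ? /=; field; rewrite y0 r0 ?d0.
Qed.

Lemma reflK L z : line_ok L -> inH z -> refl L (refl L z) = z.
Proof.
move=> ok hz; have hr := inH_refl ok hz.
apply: emb_inj; rewrite ?inE //; first exact: inH_refl.
rewrite !emb_refl // !lformE lnormal_norm //.
set a := lform _ _; rewrite (_ : 2 * (a - 2 * a * 1) = - (2 * a)); last by ring.
by rewrite scaleNr opprK subrK.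
Qed.

Lemma coshd_refl L z z' : line_ok L -> inH z -> inH z' ->
  coshd (refl L z) (refl L z') = coshd z z'.
Proof.
move=> ok hz hz'; rewrite /coshd !emb_refl // !lformE lnormal_norm //.
by rewrite (lformC (emb z) (lnormal L)); ring.
Qed.

Lemma dotp_lgrad L L' p :
  line_ok L -> line_ok L' -> on_line L p -> on_line L' p ->
  dotp (lgrad L p) (lgrad L' p)
  = lscale L * lscale L' * lform (lnormal L) (lnormal L').
Proof.
(* [lead K] is the coefficient of [|z|^2] in [lfun K z]. *)
pose lead (K : hline R) : R := if K is Circ _ _ then 2 else 0.
move=> ok ok' [_ Lp] [_ L'p].
transitivity (lead L' * lfun L p + lead L * lfun L' p
  + lscale L * lscale L' * lform (lnormal L) (lnormal L')); last first.
  by rewrite Lp L'p !mulr0 !add0r.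
case: L L' ok ok' {Lp L'p} => [a|a r] [a'|a' r'] /=;
  rewrite lform_vec3 /dotp /=.
- by move=> _ _; field.
- by move=> _ /lt0r_neq0 r'0; field.
- by move=> /lt0r_neq0 r0 _; field.
- by move=> /lt0r_neq0 r0 /lt0r_neq0 r'0; field; rewrite r0 r'0.
Qed.

Lemma enorm_lgrad L p :
  line_ok L -> on_line L p -> enorm (lgrad L p) = lscale L.
Proof.
move=> ok Lp; rewrite /enorm (dotp_lgrad ok ok Lp Lp) lnormal_norm // mulr1.
by rewrite -expr2 sqrtr_sqr gtr0_norm ?lscale_gt0.
Qed.

End Hyperboloid.

Section UnitNormals.
Variable R : realType.
Implicit Types (z p : pt R) (u v : 'rV[R]_3).

(* The foot of the perpendicular from [z] to the line with normal [u] is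
   proportional to [emb z - lform u (emb z) *: u]. *)
Lemma lform_foot_gt0 u v z : inH z -> lform u u = 1 ->
  (forall p, inH p -> lform u (emb p) = 0 -> 0 < lform v (emb p)) ->
  lform u v * lform u (emb z) < lform v (emb z).
Proof.
move=> hz u1 v_pos; set x := lform u (emb z).
have [||p hp [c c0 pE]] := @orthogonal_residue_emb _ (x *: u) z hz.
- by rewrite !lformE u1 mulr1 -expr2 sqr_ge0.
- by rewrite !lformE u1 mulr1.
have up : lform u (emb p) = 0.
  apply: (mulfI (lt0r_neq0 c0)); rewrite mulr0 -lformZr -pE.
  by rewrite !lformE u1 mulr1 subrr.
have := mulr_gt0 c0 (v_pos p hp up); rewrite -lformZr -pE.
by rewrite !lformE subr_gt0 lformC mulrC.
Qed.

Lemma common_point u v z (a := lform u v) (x := lform u (emb z))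
    (y := lform v (emb z)) : inH z -> lform u u = 1 -> lform v v = 1 ->
  -1 < a < 1 -> 0 < x -> 0 < y -> a * x < y -> a * y < x ->
  exists2 p, inH p & lform u (emb p) = 0 /\ lform v (emb p) = 0.
Proof.
move=> hz u1 v1 /andP[a_gt a_lt] x_gt0 y_gt0 ax ay.
have det_gt0 : 0 < 1 - a ^+ 2 by nra.
pose s := (x - a * y) / (1 - a ^+ 2); pose t := (y - a * x) / (1 - a ^+ 2).
have s_ge0 : 0 <= s by rewrite ltW // divr_gt0 // subr_gt0.
have t_ge0 : 0 <= t by rewrite ltW // divr_gt0 // subr_gt0.
pose n := s *: u + t *: v.
have un : lform u n = x.
  by rewrite !lformE u1 -/a /s /t; field; exact: lt0r_neq0.
have vn : lform v n = y.
  by rewrite !lformE v1 (lformC v u) -/a /s /t; field; exact: lt0r_neq0.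
have nE w : lform n w = s * lform u w + t * lform v w by rewrite !lformE.
have [||p hp [c c0 pE]] := @orthogonal_residue_emb _ n z hz.
- by rewrite nE un vn addr_ge0 // mulr_ge0 // ltW.
- by rewrite !nE un vn.
exists p => //; split; apply: (mulfI (lt0r_neq0 c0));
  by rewrite mulr0 -lformZr -pE lformDr lformNr ?un ?vn subrr.
Qed.

Lemma disjoint_lform_le u v z : inH z -> lform u u = 1 -> lform v v = 1 ->
  0 < lform u (emb z) -> 0 < lform v (emb z) ->
  (forall p, inH p -> lform u (emb p) = 0 -> 0 < lform v (emb p)) ->
  (forall p, inH p -> lform v (emb p) = 0 -> 0 < lform u (emb p)) ->
  lform u v <= -1.
Proof.
move=> hz u1 v1 x_gt0 y_gt0 v_pos u_pos.
have ax := lform_foot_gt0 hz u1 v_pos.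
have := lform_foot_gt0 hz v1 u_pos; rewrite (lformC v u) => ay.
rewrite leNgt; apply/negP => a_gt.
have a_lt : lform u v < 1.
  rewrite ltNge; apply/negP => a_ge1.
  have := ler_wpM2r (ltW x_gt0) a_ge1.
  by have := ler_wpM2r (ltW y_gt0) a_ge1; lra.
have [|p hp [up vp]] := common_point hz u1 v1 _ x_gt0 y_gt0 ax ay.
  by rewrite a_gt.
by have := v_pos p hp up; rewrite vp ltxx.
Qed.

Lemma unit_span_eq0 u v (a b : R) : lform u u = 1 -> lform v v = 1 ->
  lform u v ^+ 2 != 1 ->
  lform u (a *: u + b *: v) = 0 -> lform v (a *: u + b *: v) = 0 ->
  a = 0 /\ b = 0.
Proof.
move=> u1 v1 uvN1; rewrite !lformE u1 v1 (lformC v u) !mulr1 => un vn.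
suff b0 : b = 0 by split=> //; move: un; rewrite b0 mul0r addr0.
have det_neq0 : 1 - lform u v ^+ 2 != 0 by rewrite subr_eq0 eq_sym.
apply: (mulfI det_neq0); rewrite mulr0.
by have := congr1 ( *%R (lform u v)) un; rewrite mulr0; lra.
Qed.

End UnitNormals.

(* Zero when [z0] lies on [L]. Locked, because rewriting with [lformZl] would
   otherwise see through the definition. *)
HB.lock Definition inward_normal (R : realType) (L : hline R) (z0 : pt R) :
  'rV[R]_3 := Num.sg (lfun L z0) *: lnormal L.

Section InwardNormal.
Variable R : realType.
Implicit Types (L : hline R) (z p : pt R).

Lemma inward_normal_norm L z0 : line_ok L -> lfun L z0 != 0 ->
  lform (inward_normal L z0) (inward_normal L z0) = 1.
Proof.
move=> ok z0L; rewrite inward_normal.unlock !lformE lnormal_norm // mulr1.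
by rewrite -expr2 sqr_sg z0L.
Qed.

Lemma emb_refl_inward_normal L z0 z (n := inward_normal L z0) :
  line_ok L -> lfun L z0 != 0 -> inH z ->
  emb (refl L z) = emb z - (2 * lform n (emb z)) *: n.
Proof.
move=> ok z0L hz; rewrite emb_refl // /n inward_normal.unlock !lformE scalerA.
congr (_ - _ *: _).
by rewrite -mulrA mulrAC -expr2 sqr_sg z0L mul1r.
Qed.

Lemma inward_normal_gt0 L z0 z : line_ok L -> inH z ->
  (0 < lform (inward_normal L z0) (emb z)) = (0 < lfun L z0 * lfun L z).
Proof.
move=> ok hz; rewrite inward_normal.unlock lformZl.
have [->|z0L] := eqVneq (lfun L z0) 0.
  by rewrite sgr0 !mul0r.
rewrite [lfun L z]lfunE // {2}[lfun L z0]numEsg.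
have c0 : 0 < `|lfun L z0| * (lscale L * z.2).
  by rewrite !mulr_gt0 ?normr_gt0 ?lscale_gt0.
by rewrite -[LHS](pmulr_rgt0 _ c0); congr (_ < _); ring.
Qed.

Lemma inward_normal_eq0 L z0 p : line_ok L -> lfun L z0 != 0 -> inH p ->
  lform (inward_normal L z0) (emb p) = 0 -> on_line L p.
Proof.
move=> ok z0L hp; rewrite inward_normal.unlock lformZl => /eqP.
rewrite mulf_eq0 sgr_eq0 (negbTE z0L) /= => /eqP p0.
by split=> //; rewrite lfunE // p0 mulr0.
Qed.

Lemma on_line_nonempty L : line_ok L -> exists p, on_line L p.
Proof.
case: L => [a|a r] /= r0.
  by exists (a, 1); split; rewrite /inH //= subrr.
by exists (a, r); split; rewrite /inH //=; ring.
Qed.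

Lemma cond_disjointC L L' z0 : cond_disjoint L L' z0 -> cond_disjoint L' L z0.
Proof. by move=> [dis [h h']]; split=> // -[p [? ?]]; apply: dis; exists p. Qed.

Lemma cond_disjoint_off L L' z0 :
  line_ok L' -> cond_disjoint L L' z0 -> lfun L z0 != 0.
Proof.
move=> ok' [_ [+ _]]; have [p L'p] := on_line_nonempty ok'.
by move=> /(_ p L'p); apply: contraTneq => ->; rewrite mul0r ltxx.
Qed.

Lemma cond_disjoint_lform L L' z0 :
  line_ok L -> line_ok L' -> inH z0 -> cond_disjoint L L' z0 ->
  lform (inward_normal L z0) (inward_normal L' z0) <= -1.
Proof.
move=> ok ok' hz0 dis.
have z0L := cond_disjoint_off ok' dis.
have z0L' := cond_disjoint_off ok (cond_disjointC dis).
case: dis => _ [L_pos L'_pos].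
apply: (disjoint_lform_le hz0); rewrite ?inward_normal_norm //.
- by rewrite inward_normal_gt0 // -expr2 exprn_even_gt0.
- by rewrite inward_normal_gt0 // -expr2 exprn_even_gt0.
- move=> p hp /(inward_normal_eq0 ok z0L hp) Lp.
  by rewrite inward_normal_gt0 // L'_pos.
- move=> p hp /(inward_normal_eq0 ok' z0L' hp) L'p.
  by rewrite inward_normal_gt0 // L_pos.
Qed.

Lemma cond_angle_lform L L' z0 :
  line_ok L -> line_ok L' -> cond_angle L L' z0 ->
  exists2 m, (2 <= m)%N &
    lform (inward_normal L z0) (inward_normal L' z0) = - cos (pi / m%:R).
Proof.
move=> ok ok' [m [p [m2 [Lp [L'p [_ [_ angleE]]]]]]]; exists m => //.
move: angleE; rewrite (dotp_lgrad ok ok' Lp L'p) !enorm_lgrad // sgrM.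
rewrite inward_normal.unlock !lformE => angleE.
have c0 : lscale L * lscale L' != 0 by rewrite mulf_neq0 ?lt0r_neq0 ?lscale_gt0.
by apply: (mulfI c0); rewrite mulrN -mulNr -angleE; ring.
Qed.

End InwardNormal.

Section CompactnessAndConvergence.
Variable R : realType.

Lemma separated_leaves_compact (T : topologicalType) (f : T -> T -> R) (d : R)
    (z : nat -> T) (A : set T) : compact A ->
  (forall p, A p -> \forall q \near (p, p), f q.1 q.2 < d) ->
  (forall m, \forall n \near \oo, d <= f (z m) (z n)) ->
  \forall n \near \oo, ~ A (z n).
Proof.
move=> cptA f_lt f_ge; apply: contrapT => often.
pose F := z @ within (A \o z) \oo.
have FF : ProperFilter F.
  by apply: Build_ProperFilter; apply: contra_not often => /= empty.
have [p [Ap clFp]] := cptA F FF (filterE _ (fun n => id)).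
have [[U V] /= [pU pV] UV] := f_lt p Ap.
have [_ [[m ->] [Um _]]] : [set x | exists m, x = z m] `&` (U `&` V) !=set0.
  by apply: clFp; [exists 0%N => // n _ _; exists n | exact: filterI].
have [x [/= dx [_ Vx]]] : [set x | d <= f (z m) x] `&` (U `&` V) !=set0.
  by apply: clFp; [apply: filterS (f_ge m) => n ? _ | exact: filterI].
by have := UV (z m, x) (conj Um Vx); rewrite /= ltNge dx.
Qed.

Lemma cvgn_sqr_dist_le (u e : nat -> R) : e @ \oo --> 0 ->
  (forall m n, (m <= n)%N -> (u m - u n) ^+ 2 <= e m) -> cvgn u.
Proof.
move=> e0 u_le; apply/cauchy_cvgP/cauchy_exP => eps eps0.
have [N _ /(_ N (leqnn N)) eN] := cvgr_lt _ e0 _ (exprn_gt0 2 eps0).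
exists (u N), N => // n /= Nn; rewrite /ball /=.
rewrite -ltr_sqr ?nnegrE // ?(ltW eps0) // real_normK ?num_real //.
exact: le_lt_trans (u_le _ _ Nn) eN.
Qed.

End CompactnessAndConvergence.

Section Height.
Variable R : realType.
Implicit Types (z p : pt R).

(* The time coordinate in the hyperboloid model. *)
Definition height z : R := coshd (0, 1) z.

Lemma heightE z : inH z -> height z = (1 + (z.1 ^+ 2 + z.2 ^+ 2)) / (2 * z.2).
Proof.
by move=> /inH_neq0 y0; rewrite /height /coshd lform_vec3 /=; field.
Qed.

Lemma inH_base : inH ((0, 1) : pt R).
Proof. exact: ltr01. Qed.

Lemma height_gt0 z : inH z -> 0 < height z.
Proof. by move=> hz; apply: lt_le_trans ltr01 (coshd_ge1 inH_base hz). Qed.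

Lemma height_bounds z h : inH z -> height z <= h ->
  [/\ (2 * h)^-1 <= z.2, z.2 <= 2 * h & `|z.1| <= 2 * h].
Proof.
move=> hz zh; have h0 := lt_le_trans (height_gt0 hz) zh.
move: zh; rewrite heightE // ler_pdivrMr ?mulr_gt0 //.
move: hz; rewrite /inH; case: z => [x y] /= y0 zh.
have yh : y <= 2 * h.
  by rewrite -(ler_pM2r y0); have := sqr_ge0 x; lra.
have x2 := sqr_ge0 x; have y2 := sqr_ge0 y; split=> //.
  by rewrite -div1r ler_pdivrMr ?mulr_gt0 //; lra.
rewrite -ler_sqr ?nnegrE ?mulr_ge0 ?(ltW h0) // real_normK ?num_real //.
by have : h * y <= h * (2 * h); [rewrite ler_pM2l | lra].
Qed.

Lemma height_le_compact h : exists A : set (pt R),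
  [/\ compact A, forall p, A p -> inH p &
      forall z, inH z -> height z <= h -> A z].
Proof.
exists (`[- (2 * h), 2 * h] `*` `[(2 * Num.max 1 h)^-1, 2 * h]).
split=> [|p [_ /=]|z hz zh].
- by apply: compact_setX; exact: segment_compact.
- rewrite in_itv /= => /andP[+ _]; apply: lt_le_trans.
  by rewrite invr_gt0 mulr_gt0 // lt_max ltr01.
have h1 : 1 <= h by apply: le_trans zh; apply: coshd_ge1 inH_base hz.
have [y_ge y_le x_le] := height_bounds hz zh.
by split; rewrite /= in_itv /= -?ler_norml // max_r // y_ge.
Qed.

Lemma emb_coord_cvg (T : Type) (F : set_system T) (FF : Filter F)
    (f : T -> pt R) p j : inH p -> f @ F --> p ->
  (fun t => emb (f t) 0 j) @ F --> emb p 0 j.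
Proof.
move=> /inH_neq0 p0 f_p.
have fx : (fun t => (f t).1) @ F --> p.1 by exact: cvg_comp f_p cvg_fst.
have fy : (fun t => (f t).2) @ F --> p.2 by exact: cvg_comp f_p cvg_snd.
have fVy : (fun t => (f t).2^-1) @ F --> p.2^-1 by exact: cvgV.
under eq_fun do rewrite mxE; rewrite mxE; case: j => -[|[|[|//]]] ?.
- exact: fVy.
- exact: cvgM fx fVy.
- exact: cvgM (cvgD (cvgM fx fx) (cvgM fy fy)) fVy.
Qed.

Lemma coshd_near_lt p d : inH p -> 1 < d ->
  \forall q \near (p, p), coshd q.1 q.2 < d.
Proof.
move=> hp d1.
have fst_p j : (fun q : pt R * pt R => emb q.1 0 j) @ (p, p) --> emb p 0 j.
  by apply: emb_coord_cvg => //; exact: cvg_fst.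
have snd_p j : (fun q : pt R * pt R => emb q.2 0 j) @ (p, p) --> emb p 0 j.
  by apply: emb_coord_cvg => //; exact: cvg_snd.
suff : (fun q : pt R * pt R => coshd q.1 q.2) @ (p, p) --> coshd p p.
  by move/cvgr_lt; apply; rewrite /coshd emb_norm // opprK.
apply: cvgN; apply: cvgB; first exact: cvgM (fst_p 1) (snd_p 1).
apply: cvgM (cvg_cst _); apply: cvgD; first exact: cvgM (fst_p 0) (snd_p 2).
exact: cvgM (fst_p 2) (snd_p 0).
Qed.

End Height.

Section KleinDisk.
Variable R : realType.
Implicit Types (z : pt R) (s : nat -> pt R).

Definition klein_x z : R := 2 * z.1 / (1 + (z.1 ^+ 2 + z.2 ^+ 2)).
Definition klein_y z : R := 1 - 2 / (1 + (z.1 ^+ 2 + z.2 ^+ 2)).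

Lemma one_add_sqnorm_gt0 z : 0 < 1 + (z.1 ^+ 2 + z.2 ^+ 2).
Proof. by rewrite ltr_pwDl // addr_ge0 ?sqr_ge0. Qed.

Lemma one_sub_klein_y z : 1 - klein_y z = 2 / (1 + (z.1 ^+ 2 + z.2 ^+ 2)).
Proof. by rewrite /klein_y opprB addrC subrK. Qed.

Lemma klein_sqdist_le z z' : inH z -> inH z' ->
  (klein_x z - klein_x z') ^+ 2 + (klein_y z - klein_y z') ^+ 2
  <= 2 * coshd z z' / (height z * height z').
Proof.
move=> hz hz'.
have -> : (klein_x z - klein_x z') ^+ 2 + (klein_y z - klein_y z') ^+ 2
    = 2 * coshd z z' / (height z * height z')
      - ((height z)^-1 ^+ 2 + (height z')^-1 ^+ 2).
  rewrite coshdE // !heightE // /klein_x /klein_y.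
  have := one_add_sqnorm_gt0 z; have := one_add_sqnorm_gt0 z'.
  move: hz hz'; rewrite /inH; case: z z' => [x y] [x' y'] /=.
  move=> /lt0r_neq0 y0 /lt0r_neq0 y'0 /lt0r_neq0 w'0 /lt0r_neq0 w0.
  by field; rewrite y0 y'0 w0 w'0.
by rewrite lerBlDr lerDl addr_ge0 ?sqr_ge0.
Qed.

Lemma inv_height_cvg0 s : (forall m, inH (s m)) ->
  (fun m => height (s m)) @ \oo --> +oo ->
  (fun m => (height (s m))^-1) @ \oo --> 0.
Proof.
move=> hs s_height; apply/gtr0_cvgV0 => //.
by apply: nearW => m; exact: height_gt0.
Qed.

Lemma conv_bdry_klein s (a b : R) : (forall m, inH (s m)) ->
  (fun m => klein_x (s m)) @ \oo --> a ->
  (fun m => klein_y (s m)) @ \oo --> b ->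
  (fun m => height (s m)) @ \oo --> +oo -> exists zeta, conv_bdry s zeta.
Proof.
move=> hs s_a s_b s_height; have w0 m := one_add_sqnorm_gt0 (s m).
have inv_height := inv_height_cvg0 hs s_height.
have [b1|b1] := eqVneq b 1.
  exists None => M; have M0 : 0 < `|M| + 1 by rewrite ltr_wpDl.
  have /cvgrPdist_lt/(_ _ (divr_gt0 (ltr0Sn R 1) M0)) := s_b.
  apply: filterS => m /=; rewrite b1 one_sub_klein_y.
  rewrite ger0_norm ?divr_ge0 ?(ltW (w0 m)) // ltr_pM2l // ltf_pV2 ?posrE //.
  by rewrite addrC ltrD2l; apply: le_lt_trans; exact: ler_norm.
have inv_klein : (fun m => (1 - klein_y (s m))^-1) @ \oo --> (1 - b)^-1.
  by apply: cvgV; [rewrite subr_eq0 eq_sym|apply: cvgB s_b; exact: cvg_cst].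
exists (Some (a / (1 - b))); split.
  rewrite (_ : (fun m => _) = fun m => klein_x (s m) * (1 - klein_y (s m))^-1).
    exact: cvgM.
  apply/funext => m; have /lt0r_neq0 wN0 := w0 m.
  by rewrite one_sub_klein_y /klein_x; field.
rewrite (_ : (fun m => _)
  = fun m => (1 - klein_y (s m))^-1 * (height (s m))^-1).
  by rewrite -[0](mulr0 (1 - b)^-1); exact: cvgM.
apply/funext => m; have /lt0r_neq0 wN0 := w0 m.
by rewrite one_sub_klein_y heightE //; field; rewrite wN0 inH_neq0.
Qed.

End KleinDisk.

Section BoundaryLimit.
Variables (R : realType) (s : nat -> pt R) (d : R).
Hypothesis inH_s : forall m, inH (s m).
Hypothesis d_gt1 : 1 < d.
Hypothesis coshd_le : forall m n, (m <= n)%N ->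
  coshd (s m) (s n) <= coshd (s 0%N) (s n).
Hypothesis coshd_sep : forall m, \forall n \near \oo, d <= coshd (s m) (s n).

Lemma height_cvgy : (fun m => height (s m)) @ \oo --> +oo.
Proof.
apply/cvgryPgt => h; have [A [cptA inA leA]] := height_le_compact h.
have := separated_leaves_compact cptA
  (fun p Ap => coshd_near_lt (inA p Ap) d_gt1) coshd_sep.
by apply: filterS => n; apply: contra_notT; rewrite -leNgt; exact: leA.
Qed.

Lemma klein_sqdist_tail_le m n : (m <= n)%N ->
  (klein_x (s m) - klein_x (s n)) ^+ 2 + (klein_y (s m) - klein_y (s n)) ^+ 2
  <= 4 * height (s 0%N) * (height (s m))^-1.
Proof.
move=> mn; apply: le_trans (klein_sqdist_le (inH_s m) (inH_s n)) _.
have hm := height_gt0 (inH_s m); have hn := height_gt0 (inH_s n).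
rewrite ler_pdivrMr ?mulr_gt0 // -(mulrA _ _^-1) mulKf ?lt0r_neq0 //.
have := coshd_le mn; have := coshd_triangle (inH_s 0%N) (inH_base R) (inH_s n).
by rewrite (coshdC (s 0%N) (0, 1)) -!/(height _); lra.
Qed.

Lemma klein_coord_cvg (k : pt R -> R) :
  (forall p q, (k p - k q) ^+ 2
    <= (klein_x p - klein_x q) ^+ 2 + (klein_y p - klein_y q) ^+ 2) ->
  cvgn (fun m => k (s m)).
Proof.
move=> k_le; apply: cvgn_sqr_dist_le => [|m n mn]; last first.
  exact: le_trans (k_le _ _) (klein_sqdist_tail_le mn).
rewrite -[X in _ --> X](mulr0 (4 * height (s 0%N))).
apply: cvgM; first exact: cvg_cst.
exact: inv_height_cvg0 inH_s height_cvgy.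
Qed.

Lemma boundary_limit : exists zeta, conv_bdry s zeta.
Proof.
have /cvg_ex[/= a s_a] : cvgn (fun m => klein_x (s m)).
  by apply: klein_coord_cvg => p q; rewrite lerDl sqr_ge0.
have /cvg_ex[/= b s_b] : cvgn (fun m => klein_y (s m)).
  by apply: klein_coord_cvg => p q; rewrite lerDr sqr_ge0.
exact: conv_bdry_klein inH_s s_a s_b height_cvgy.
Qed.

End BoundaryLimit.

Section Chebyshev.
Variable R : realType.
Implicit Types (c t x y : R) (k m : nat).

(* The Chebyshev polynomials of the second kind, shifted by one:
   [cheb (cos t) k = sin (k t) / sin t]. *)
Fixpoint cheb c k : R :=
  match k with
  | 0 => 0
  | k'.+1 => if k' is k''.+1 then 2 * c * cheb c k' - cheb c k'' else 1
  end.

Lemma chebSS c k : cheb c k.+2 = 2 * c * cheb c k.+1 - cheb c k.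
Proof. by []. Qed.

Lemma cheb_ge0_lt c k : 1 <= c -> 0 <= cheb c k < cheb c k.+1.
Proof.
move=> c_ge1; elim: k => [|k /andP[k_ge0 k_lt]]; first by rewrite /= lexx ltr01.
have Sk_ge0 : 0 <= cheb c k.+1 by rewrite ltW // (le_lt_trans k_ge0).
by rewrite Sk_ge0 chebSS; have := ler_peMl Sk_ge0 c_ge1; lra.
Qed.

Lemma cheb_cos_mul_sin t k : cheb (cos t) k * sin t = sin (k%:R * t).
Proof.
suff : cheb (cos t) k * sin t = sin (k%:R * t) /\
       cheb (cos t) k.+1 * sin t = sin (k.+1%:R * t) by case.
elim: k => [|k [IHk IHSk]]; first by rewrite /= !mul0r sin0 !mul1r.
split=> //; rewrite chebSS mulrBl IHk -!mulrA IHSk.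
have -> : k.+2%:R * t = k.+1%:R * t + t.
  by rewrite -[k.+2]addn1 natrD mulrDl mul1r.
have -> : k%:R * t = k.+1%:R * t - t.
  by rewrite -[k.+1]addn1 natrD mulrDl mul1r addrK.
by rewrite sinB sinD; ring.
Qed.

Section DihedralAngle.
Variable m : nat.
Hypothesis m_ge2 : (2 <= m)%N.
Local Notation t := (pi / m%:R : R).

Lemma pi_div_bounds : 0 < t <= pi / 2.
Proof.
have m0 : 0 < m%:R :> R by rewrite ltr0n ltnW.
by rewrite divr_gt0 ?pi_gt0 // ler_pM2l ?pi_gt0 // lef_pV2 ?posrE // ler_nat.
Qed.

Lemma sin_pi_div_gt0 : 0 < sin t.
Proof.
have /andP[t0 t_le] := pi_div_bounds; apply: sin_gt0_pi.
by have := pi_gt0 R; lra.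
Qed.

Lemma cos_pi_div_ge0 : 0 <= cos t.
Proof.
have /andP[t0 t_le] := pi_div_bounds; apply: cos_ge0_pihalf.
by have := pi_gt0 R; lra.
Qed.

Lemma cos_pi_div_sqr_lt1 : cos t ^+ 2 < 1.
Proof. by have := cos2Dsin2 t; have := exprn_gt0 2 sin_pi_div_gt0; lra. Qed.

Lemma mul_pi_div : m%:R * t = pi.
Proof. by rewrite mulrC divfK // pnatr_eq0 -lt0n ltnW. Qed.

Lemma cheb_cos_pi_div_gt0 k : (0 < k < m)%N -> 0 < cheb (cos t) k.
Proof.
move=> /andP[k0 km]; rewrite -(pmulr_lgt0 _ sin_pi_div_gt0) cheb_cos_mul_sin.
have /andP[t0 _] := pi_div_bounds; apply: sin_gt0_pi.
by rewrite pmulr_lgt0 ?ltr0n // k0 -{2}mul_pi_div ltr_pM2r // ltr_nat.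
Qed.

Lemma cheb_cos_pi_div_eq0 : cheb (cos t) m = 0.
Proof.
apply: (mulIf (lt0r_neq0 sin_pi_div_gt0)).
by rewrite cheb_cos_mul_sin mul_pi_div sinpi mul0r.
Qed.

Lemma cheb_cos_pi_div_eqN1 : cheb (cos t) m.+1 = -1.
Proof.
apply: (mulIf (lt0r_neq0 sin_pi_div_gt0)).
rewrite cheb_cos_mul_sin -addn1 natrD mulrDl mul_pi_div mul1r.
by rewrite sinD sinpi cospi; ring.
Qed.

End DihedralAngle.

(* The products of the inward normals of two sides of a Coxeter polygon: at most
   [-1] for disjoint sides, [- cos (pi / m)] at a vertex of angle [pi / m]. *)
Definition coxeter_entry (a : R) : Prop :=
  a <= -1 \/ exists2 m, (2 <= m)%N & a = - cos (pi / m%:R).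

Lemma coxeter_entry_le0 a : coxeter_entry a -> a <= 0.
Proof.
move=> [a_le|[m m2 ->]]; first exact: le_trans a_le (lerN10 R).
by rewrite oppr_le0 cos_pi_div_ge0.
Qed.

Lemma cheb_comb_gt0 a k x y : coxeter_entry a ->
  (forall m, (2 <= m)%N -> a = - cos (pi / m%:R) -> (k < m)%N) ->
  0 < x -> 0 < y -> 0 < cheb (- a) k.+1 * x + cheb (- a) k * y.
Proof.
move=> [a_le|[m m2 aE]] lt_m x0 y0.
  have Na_ge1 : 1 <= - a by rewrite lerNr.
  have /andP[k_ge0 k_lt] := cheb_ge0_lt k Na_ge1.
  have Sk_gt0 := le_lt_trans k_ge0 k_lt.
  by rewrite ltr_pwDl ?(mulr_gt0 Sk_gt0) // (mulr_ge0 k_ge0) // ltW.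
have km := lt_m m m2 aE; rewrite aE opprK.
have [Sk|Sk] := ltnP k.+1 m; last first.
  have mE : m = k.+1 by apply/eqP; rewrite eqn_leq Sk.
  rewrite -{1}mE cheb_cos_pi_div_eq0 // mul0r add0r mulr_gt0 //.
  by apply: cheb_cos_pi_div_gt0; rewrite // km -ltnS -mE m2.
have k_ge0 : 0 <= cheb (cos (pi / m%:R)) k.
  by case: (posnP k) => [-> //|k0]; rewrite ltW // cheb_cos_pi_div_gt0 // k0.
have Sk_gt0 := cheb_cos_pi_div_gt0 m2 (Sk : 0 < k.+1 < m)%N.
by rewrite ltr_pwDl ?(mulr_gt0 Sk_gt0) // (mulr_ge0 k_ge0) // ltW.
Qed.

End Chebyshev.
Arguments cheb : simpl never.

Section AlternatingWords.
Variable T : Type.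
Implicit Types (p : T * T) (k m : nat).

Fixpoint alt k p : seq T :=
  if k is k'.+1 then rcons (alt k' (swap_pair p)) p.2 else [::].

Lemma size_alt k p : size (alt k p) = k.
Proof. by elim: k p => //= k IHk p; rewrite size_rcons IHk. Qed.

Lemma alt_addn k m p : alt (k + m) p = alt k (iter m swap_pair p) ++ alt m p.
Proof.
elim: m p => [|m IHm] p; first by rewrite addn0 cats0.
by rewrite addnS iterSr /= IHm rcons_cat.
Qed.

Lemma iter_swap_pair_all (P : T -> Prop) k p : P p.1 -> P p.2 ->
  P (iter k swap_pair p).1 /\ P (iter k swap_pair p).2.
Proof. by move=> P1 P2; elim: k => //= k []. Qed.

End AlternatingWords.

Section Words.
Variables (R : realType) (L : 'I_3 -> hline R).
Hypothesis okL : forall i, line_ok (L i).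
Implicit Types (i j : 'I_3) (u v w : seq 'I_3) (z : pt R) (m n : nat).

Lemma act_cat v w z : act L (v ++ w) z = act L v (act L w z).
Proof. exact: foldr_cat. Qed.

Lemma act_rcons w i z : act L (rcons w i) z = act L w (refl (L i) z).
Proof. exact: foldr_rcons. Qed.

Lemma inH_act w z : inH z -> inH (act L w z).
Proof. by move=> hz; elim: w => //= i w; exact: inH_refl. Qed.

Lemma act_revK w z : inH z -> act L (rev w) (act L w z) = z.
Proof.
move=> hz; elim: w => [|i w IHw] //=; rewrite rev_cons act_rcons reflK //.
exact: inH_act.
Qed.

Lemma coshd_act w z z' : inH z -> inH z' ->
  coshd (act L w z) (act L w z') = coshd z z'.
Proof.
move=> hz hz'; elim: w => //= i w <-.
by rewrite coshd_refl //; exact: inH_act.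
Qed.

Lemma coshd_act_cat v w z : inH z ->
  coshd (act L v z) (act L (v ++ w) z) = coshd z (act L w z).
Proof. by move=> hz; rewrite act_cat coshd_act //; exact: inH_act. Qed.

Lemma word_eq_refl w : word_eq L w w.
Proof. by []. Qed.

Lemma word_eq_sym v w : word_eq L v w -> word_eq L w v.
Proof. by move=> vw z hz; rewrite vw. Qed.

Lemma word_eq_trans u v w : word_eq L u v -> word_eq L v w -> word_eq L u w.
Proof. by move=> uv vw z hz; rewrite uv // vw. Qed.

Lemma word_eq_cat v v' w w' : word_eq L v v' -> word_eq L w w' ->
  word_eq L (v ++ w) (v' ++ w').
Proof.
by move=> vv' ww' z hz; rewrite !act_cat ww' // vv' //; exact: inH_act.
Qed.

Lemma word_eq_rcons v w i :
  word_eq L v w -> word_eq L (rcons v i) (rcons w i).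
Proof. by move=> vw; rewrite -!cats1; exact: word_eq_cat. Qed.

Lemma word_eq_rcons2 w i : word_eq L (rcons (rcons w i) i) w.
Proof. by move=> z hz; rewrite !act_rcons reflK. Qed.

Lemma word_eq_rev v w : word_eq L v w -> word_eq L (rev v) (rev w).
Proof.
move=> vw z hz; have hw := inH_act (rev w) hz.
by rewrite -[RHS](act_revK v hw) vw // -{1}[w]revK act_revK.
Qed.

Lemma ell_min v w : word_eq L v w -> (ell L v <= size w)%N.
Proof.
move=> vw; rewrite /ell; case: ex_minnP => n _; apply.
by apply/asboolP; exists w.
Qed.

Lemma exists_reduced_word w : exists2 v, word_eq L w v & size v = ell L w.
Proof.
by rewrite /ell; case: ex_minnP => n /asboolP[v [wv sv]] _; exists v.
Qed.

Lemma word_eq_ell v w : word_eq L v w -> ell L v = ell L w.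
Proof.
have ell_le u u' : word_eq L u u' -> (ell L u <= ell L u')%N.
  move=> uu'; have [x u'x <-] := exists_reduced_word u'.
  exact: ell_min (word_eq_trans uu' u'x).
move=> vw; apply/eqP; rewrite eqn_leq !ell_le //; exact: word_eq_sym.
Qed.

Lemma ell_size w : (ell L w <= size w)%N.
Proof. exact: ell_min (word_eq_refl w). Qed.

Lemma ell_rev w : ell L (rev w) = ell L w.
Proof.
have ell_rev_le u : (ell L (rev u) <= ell L u)%N.
  have [v uv <-] := exists_reduced_word u.
  by rewrite -size_rev; exact/ell_min/word_eq_rev.
by apply/eqP; rewrite eqn_leq ell_rev_le -{1}[w]revK ell_rev_le.
Qed.

Lemma ell_cat v w : (ell L (v ++ w) <= ell L v + size w)%N.
Proof.
have [u vu <-] := exists_reduced_word v.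
by rewrite -size_cat; apply: ell_min; exact: word_eq_cat.
Qed.

Lemma ell_rcons w i : (ell L (rcons w i) <= (ell L w).+1)%N.
Proof. by rewrite -cats1 (leq_trans (ell_cat _ _)) // addn1. Qed.

Lemma word_eq_nil_or_descent w :
  word_eq L w [::] \/ exists j, (ell L (rcons w j) < ell L w)%N.
Proof.
have [v wv sv] := exists_reduced_word w.
case/lastP: v => [|v j] in wv sv *; [by left|right; exists j].
rewrite -sv size_rcons ltnS; apply: ell_min.
exact: word_eq_trans (word_eq_rcons j wv) (word_eq_rcons2 v j).
Qed.

(* Strip from the right end of [w] the letters [p.2], [p.1], [p.2], ... for as
   long as they are descents. *)
Lemma dihedral_factor w p : (ell L w <= ell L (rcons w p.1))%N ->
  exists v k, [/\ word_eq L w (v ++ alt k p), ell L w = (ell L v + k)%N,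
    (ell L v <= ell L (rcons v p.1))%N & (ell L v <= ell L (rcons v p.2))%N].
Proof.
have [n] := ubnP (ell L w); elim: n w p => // n IHn w p wn asc1.
have [asc2|desc2] := leqP (ell L w) (ell L (rcons w p.2)).
  by exists w, 0%N; rewrite cats0 addn0; split.
have ell_w2 := word_eq_ell (word_eq_rcons2 w p.2).
have ellE : ell L w = (ell L (rcons w p.2)).+1.
  by apply/eqP; rewrite eqn_leq desc2 -{1}ell_w2 ell_rcons.
have [||v [k [wv ell_v v2 v1]]] := IHn (rcons w p.2) (swap_pair p).
- by rewrite -ellE.
- by rewrite /= ell_w2 ltnW.
exists v, k.+1; split=> //; last by rewrite ellE ell_v addnS.
apply: word_eq_trans (word_eq_sym (word_eq_rcons2 w p.2)) _.
by rewrite /= -rcons_cat; exact: word_eq_rcons.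
Qed.

Definition reduced w := ell L w = size w.

Lemma reduced_catr v w : reduced (v ++ w) -> reduced w.
Proof.
rewrite /reduced size_cat => vw_red; have := ell_cat (rev w) (rev v).
by rewrite -rev_cat !ell_rev size_rev vw_red; have := ell_size w; lia.
Qed.

Lemma reduced_demazure idx m : reduced (demazure L idx m).
Proof.
elim: m => [|m IHm] /=; first by apply/eqP; rewrite -leqn0 ell_size.
case: ifP => // asc; apply/eqP.
by rewrite eqn_leq ell_size size_rcons -[size _]IHm.
Qed.

Lemma demazure_cat idx m n : (m <= n)%N -> exists2 w,
  demazure L idx n = demazure L idx m ++ w & reduced (demazure L idx m ++ w).
Proof.
suff /(_ (n - m)%N)[w] : forall k, exists w,
    demazure L idx (k + m) = demazure L idx m ++ w.
  move=> wE /subnK nE; rewrite nE in wE; exists w => //.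
  by rewrite -wE; exact: reduced_demazure.
elim=> [|k [w IHk]]; first by exists [::]; rewrite cats0.
rewrite addSn /= IHk; case: ifP => _; last by exists w.
by exists (rcons w (idx (k + m)%N)); rewrite rcons_cat.
Qed.

Lemma demazure_word_eq idx m n : (m <= n)%N ->
  word_eq L (demazure L idx n) (demazure L idx m) ->
  demazure L idx n = demazure L idx m.
Proof.
move=> /(demazure_cat idx)[w nE red] /word_eq_ell ell_nm.
move: ell_nm; rewrite nE red reduced_demazure size_cat -[RHS]addn0.
by move/addnI/size0nil ->; rewrite cats0.
Qed.

Lemma demazure_grows idx m : ~ eventually_const L (demazure L idx) ->
  \forall n \near \oo, exists w,
    [/\ w != [::], demazure L idx n = demazure L idx m ++ w & reduced w].
Proof.
move=> not_const.
have [n mn neq] : exists2 n, (m <= n)%N & demazure L idx n <> demazure L idx m.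
  apply: contrapT => const; apply: not_const; exists m => n mn.
  suff -> : demazure L idx n = demazure L idx m by [].
  by apply: contrapT => neq; apply: const; exists n.
exists n => // n' /= nn'.
have [v nE _] := demazure_cat idx mn; have [w n'E _] := demazure_cat idx nn'.
have [x n'E' red] := demazure_cat idx (leq_trans mn nn').
exists x; split=> //; last exact: (reduced_catr red).
apply: contra_not_neq neq => x0; move: n'E; rewrite n'E' x0 nE -catA => /eqP.
by rewrite eqseq_cat // eqxx /=; case: v {nE} => //; rewrite cats0.
Qed.

End Words.

Section FundamentalChamber.
Variables (R : realType) (L : 'I_3 -> hline R) (z0 : pt R).
Hypothesis okL : forall i, line_ok (L i).
Hypothesis hz0 : inH z0.
Hypothesis chamber : forall i j : 'I_3, i != j ->
  cond_disjoint (L i) (L j) z0 \/ cond_angle (L i) (L j) z0.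
Implicit Types (i j : 'I_3) (p : 'I_3 * 'I_3) (v w : seq 'I_3) (z : pt R).

Local Notation e i := (inward_normal (L i) z0).
Local Notation side i z := (lform (e i) (emb z)).

Lemma lfun_chamber_neq0 i : lfun (L i) z0 != 0.
Proof.
have [j ij] : exists j : 'I_3, i != j by exists (i + 1); case: i => -[|[|[|]]].
case: (chamber ij) => [|[m [q [_ [_ [_ []]]]]] //].
exact: cond_disjoint_off.
Qed.

Lemma chamber_norm i : lform (e i) (e i) = 1.
Proof. exact: inward_normal_norm (okL i) (lfun_chamber_neq0 i). Qed.

Lemma chamber_gram i j : i != j -> coxeter_entry (lform (e i) (e j)).
Proof.
case/chamber => [|]; first by left; exact: cond_disjoint_lform.
by right; exact: cond_angle_lform.
Qed.

Lemma chamber_side_gt0 i : 0 < side i z0.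
Proof.
by rewrite inward_normal_gt0 // -expr2 exprn_even_gt0 ?lfun_chamber_neq0.
Qed.

Lemma chamber_emb_refl i z : inH z ->
  emb (refl (L i) z) = emb z - (2 * side i z) *: e i.
Proof. exact: emb_refl_inward_normal (okL i) (lfun_chamber_neq0 i). Qed.

Lemma side_refl i z : inH z -> side i (refl (L i) z) = - side i z.
Proof.
by move=> hz; rewrite chamber_emb_refl // !lformE chamber_norm; ring.
Qed.

(* [2 * c * cheb c k - cheb c k.+1] plays the role of [cheb c (k - 1)], which is
   [-1] at [k = 0]. *)
Lemma side_rev_alt k p z (c := - lform (e p.1) (e p.2))
    (q := iter k swap_pair p) (y := act L (rev (alt k p)) z) : inH z ->
  side p.1 y = cheb c k.+1 * side q.1 z + cheb c k * side q.2 z /\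
  side p.2 y = - (cheb c k * side q.1 z
                  + (2 * c * cheb c k - cheb c k.+1) * side q.2 z).
Proof.
move=> hz; elim: k p @c @q @y => [|k IHk] p /=.
  by rewrite /cheb; split; ring.
have := IHk (swap_pair p).
rewrite rev_rcons -iterSr /= (lformC (e p.2) (e p.1)).
set y := act _ _ _ => -[side2 side1]; have hy : inH y by exact: inH_act.
rewrite side_refl // chamber_emb_refl // !lformE side1 side2 chebSS.
by split; ring.
Qed.

Lemma emb_rev_alt k p z : inH z -> exists a b,
  emb (act L (rev (alt k p)) z) = emb z + (a *: e p.1 + b *: e p.2).
Proof.
move=> hz; elim: k p => [|k IHk] p.
  by exists 0, 0; rewrite !scale0r !addr0.
have [a [b yE]] := IHk (swap_pair p); rewrite /= rev_rcons /=.
set y := act _ _ _ in yE *; exists b, (a - 2 * side p.2 y).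
rewrite chamber_emb_refl ?yE /=; last exact: inH_act.
by rewrite scalerBl (addrC (a *: _)) !addrA.
Qed.

(* Both sides move [emb z] inside the plane spanned by [e p.1] and [e p.2], on
   which the form is nondegenerate, and have the same products with [e p.1] and
   [e p.2]. *)
Lemma braid m p : (2 <= m)%N -> lform (e p.1) (e p.2) = - cos (pi / m%:R) ->
  word_eq L (alt m p) (alt m (swap_pair p)).
Proof.
move=> m2 gramE; suff : word_eq L (rev (alt m p)) (rev (alt m (swap_pair p))).
  by move/(word_eq_rev okL); rewrite !revK.
move=> z hz; apply: emb_inj; rewrite ?inE; [exact: inH_act|exact: inH_act|].
have [a [b yE]] := emb_rev_alt m p hz.
have [a' [b' y'E]] := emb_rev_alt m (swap_pair p) hz.
have [] := side_rev_alt m p hz; have [] := side_rev_alt m (swap_pair p) hz.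
rewrite -iterSr /= (lformC (e p.2) (e p.1)) gramE opprK.
rewrite cheb_cos_pi_div_eq0 // cheb_cos_pi_div_eqN1 // yE y'E !lformDr /=.
move=> side2' side1' side1 side2.
have [|||||/eqP a0 /eqP b0] :=
  @unit_span_eq0 _ (e p.1) (e p.2) (a - b') (b - a').
- exact: chamber_norm.
- exact: chamber_norm.
- by rewrite gramE sqrrN lt_eqF // cos_pi_div_sqr_lt1.
- by move: side1 side1'; rewrite !lformE; lra.
- by move: side2 side2'; rewrite !lformE; lra.
by move: a0 b0; rewrite !subr_eq0 => /eqP -> /eqP ->; rewrite (addrC (a' *: _)).
Qed.

(* Otherwise a braid move makes [w] end in [p.1], against the ascent. *)
Lemma ascent_alt_lt m k v w p : (2 <= m)%N ->
  lform (e p.1) (e p.2) = - cos (pi / m%:R) ->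
  word_eq L w (v ++ alt k p) -> ell L w = (ell L v + k)%N ->
  (ell L w <= ell L (rcons w p.1))%N -> (k < m)%N.
Proof.
move=> m2 gramE wE ellE; rewrite ltnNge; apply: contraTN => mk; rewrite -ltnNge.
pose r := alt (k - m) (iter m swap_pair p).
suff /word_eq_ell -> : word_eq L (rcons w p.1) ((v ++ r) ++ alt m.-1 p).
  rewrite (leq_ltn_trans (ell_cat okL _ _)) // size_alt.
  by have := ell_cat okL v r; rewrite size_alt ellE; lia.
apply: word_eq_trans (word_eq_rcons okL _ wE) _.
rewrite -(subnK mk) alt_addn catA -/r.
have braid_v := word_eq_cat okL (word_eq_refl L (v ++ r)) (braid m2 gramE).
apply: word_eq_trans (word_eq_rcons okL _ braid_v) _.
rewrite -{1}(prednK (ltnW m2)) /= -rcons_cat swap_pairK.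
exact: word_eq_rcons2.
Qed.

(* As for the geometric representation of a Coxeter group: [w] is a product of
   an element [v] ascending at two letters and an element of the dihedral group
   that they generate, and the claim for [v] is known by induction. *)
Lemma ascent_side_gt0 w i : (ell L w <= ell L (rcons w i))%N ->
  0 < side i (act L (rev w) z0).
Proof.
have [n] := ubnP (ell L w); elim: n w i => // n IHn w i wn asc.
have [w1|[j desc]] := word_eq_nil_or_descent okL w.
  by rewrite (word_eq_rev okL w1) // chamber_side_gt0.
have ij : i != j by apply: contraTneq asc => ->; rewrite -ltnNge.
have [v [k [wE ellE v_i v_j]]] := dihedral_factor okL (p := (i, j)) asc.
have vn : (ell L v < n)%N.
  case: k => [|k] in wE ellE *; last by lia.
  move: desc; rewrite ellE (word_eq_ell (word_eq_rcons okL j wE)).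
  by rewrite cats0 addn0 ltnNge v_j.
rewrite (word_eq_rev okL wE) // rev_cat act_cat.
have [-> _] := side_rev_alt k (i, j) (inH_act okL (rev v) hz0).
have [q1 q2] := @iter_swap_pair_all _ (fun l => 0 < side l (act L (rev v) z0))
  k (i, j) (IHn v i vn v_i) (IHn v j vn v_j).
apply: cheb_comb_gt0 => // [|m m2 gramE]; first exact: chamber_gram.
exact: (ascent_alt_lt (p := (i, j)) m2 gramE wE ellE asc).
Qed.

Lemma descent_side_lt0 w i : (ell L (rcons w i) <= ell L w)%N ->
  side i (act L (rev w) z0) < 0.
Proof.
move=> desc; have := @ascent_side_gt0 (rcons w i) i.
rewrite (word_eq_ell (word_eq_rcons2 okL w i)) => /(_ desc).
by rewrite rev_rcons /= side_refl ?oppr_gt0 //; exact: inH_act.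
Qed.

Lemma exists_side_gt0 z : inH z -> exists i, 0 < side i z.
Proof.
move=> hz; have [i j ij||x [x_ge0 [j xj_gt0] causal]] :=
  @obtuse_family_causal_comb _ 3 (fun i => e i) (emb z0) isT.
- exact: coxeter_entry_le0 (chamber_gram ij).
- by rewrite emb_norm // oppr_lt0 ltr01.
have comb_gt0 : 0 < lform (\sum_i x i *: e i) (emb z0).
  rewrite lform_suml (bigD1 j) //= ltr_pwDl ?mulr_gt0 ?chamber_side_gt0 //.
  by rewrite sumr_ge0 // => i _; rewrite mulr_ge0 // ltW ?chamber_side_gt0.
apply: contrapT => /forallNP side_le0.
have := causal_lform_gt0 causal hz0 hz comb_gt0; rewrite lform_suml ltNge.
move=> /negP; apply; apply: sumr_le0 => i _; rewrite mulr_ge0_le0 //.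
by rewrite leNgt; apply/negP.
Qed.

Lemma reduced_cons_side_gt0 i w : reduced L (i :: w) -> 0 < side i (act L w z0).
Proof.
move=> iw_red; rewrite -[w]revK; apply: ascent_side_gt0.
by rewrite -rev_cons !ell_rev // iw_red (leq_trans (ell_size L w)).
Qed.

Lemma coshd_act_le_cat v w : reduced L (v ++ w) ->
  coshd z0 (act L w z0) <= coshd z0 (act L (v ++ w) z0).
Proof.
elim: v => //= i v IHv red; apply: le_trans (IHv _) _.
  exact: (reduced_catr okL (v := [:: i]) red).
have hw := inH_act okL (v ++ w) hz0.
rewrite /coshd chamber_emb_refl // !lformE (lformC (emb z0) (e i)) lerN2 gerBl.
by rewrite !mulr_ge0 // ltW ?chamber_side_gt0 ?reduced_cons_side_gt0.
Qed.

(* The line of the first letter of [w] separates [z0] from its image. *)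
Lemma reduced_coshd_separated : exists2 d : R, 1 < d &
  forall w, reduced L w -> w != [::] -> d <= coshd z0 (act L w z0).
Proof.
pose f i := Num.sqrt (1 + side i z0 ^+ 2).
have f_gt1 i : 1 < f i.
  rewrite -[X in X < _]sqrtr1 ltr_sqrt; last by rewrite ltr_wpDr ?sqr_ge0.
  by rewrite ltrDl exprn_gt0 ?chamber_side_gt0.
have f_le i : \big[Num.min/f 0]_j f j <= f i by exact: bigmin_le.
exists (\big[Num.min/f 0]_i f i); first by apply/bigmin_gtP; split.
move=> [//|i w] red _; apply: le_trans (f_le i) _.
have hw := inH_act okL w hz0; have hiw := inH_act okL (i :: w) hz0.
rewrite -[leRHS]ger0_norm; last by rewrite (le_trans ler01) // coshd_ge1.
rewrite -sqrtr_sqr ler_wsqrtr // coshd_sqr_ge_opposite ?chamber_norm //=.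
rewrite side_refl // mulr_ge0_le0 ?oppr_le0 // ltW ?chamber_side_gt0 //.
exact: reduced_cons_side_gt0.
Qed.

Lemma demazure_not_eventually_const idx :
  (forall N k, exists2 m, (N <= m)%N & idx m = k) ->
  ~ eventually_const L (demazure L idx).
Proof.
move=> recur [N const]; set u := demazure L idx N in const.
have [i side_gt0] := exists_side_gt0 (inH_act okL (rev u) hz0).
have [m Nm idx_m] := recur N i.
have uE : demazure L idx m = u by apply: demazure_word_eq => //; exact: const.
have := word_eq_ell (const m.+1 (leqW Nm)); rewrite /= uE idx_m.
case: ltnP => [asc ell_eq|desc _]; first by rewrite ell_eq ltnn in asc.
by have := lt_trans side_gt0 (descent_side_lt0 desc); rewrite ltxx.
Qed.

Lemma demazure_boundary_limit idx : ~ eventually_const L (demazure L idx) ->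
  exists zeta, conv_bdry (fun m => act L (demazure L idx m) z0) zeta.
Proof.
move=> not_const; have [d d_gt1 d_le] := reduced_coshd_separated.
apply: (boundary_limit (d := d)) => // [m|m n mn|m]; first exact: inH_act.
  have [w -> red] := demazure_cat L idx mn; rewrite coshd_act_cat //.
  exact: coshd_act_le_cat.
apply: filterS (demazure_grows okL m not_const) => n [w [w0 -> red]].
by rewrite coshd_act_cat // d_le.
Qed.

End FundamentalChamber.

Section UniformLetters.
Variables (R : realType) (d : measure_display) (T : measurableType d).
Variables (P : probability T R) (a : nat) (I : nat -> T -> 'I_a.+1).
Hypothesis measurable_letter : forall m k, measurable [set w | I m w = k].

Definition cylinder (ks : seq 'I_a.+1) : set T :=
  [set w | forall m, (m < size ks)%N -> I m w = nth ord0 ks m].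

Hypothesis cylinder_prob : forall ks,
  P (cylinder ks) = ((1 / a.+1%:R) ^+ size ks)%:E.

Definition avoids k (D : set nat) : set T :=
  [set w | forall m, D m -> I m w <> k].

Lemma measurable_cylinder ks : measurable (cylinder ks).
Proof.
rewrite (_ : cylinder ks =
  \bigcap_(m in [set m | (m < size ks)%N]) [set w | I m w = nth ord0 ks m]) //.
exact: bigcap_measurableType.
Qed.

Lemma measurable_avoids k D : measurable (avoids k D).
Proof.
rewrite (_ : avoids k D = \bigcap_(m in D) ~` [set w | I m w = k]) //.
by apply: bigcap_measurableType => m _; exact: measurableC.
Qed.

Definition words_avoiding k n M : pred {ffun 'I_(n + M) -> 'I_a.+1} :=
  family (fun i : 'I_(n + M) => if (i < n)%N then predT else predC1 k).
Arguments words_avoiding : clear implicits.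

Lemma card_words_avoiding k n M :
  #|words_avoiding k n M| = (a.+1 ^ n * a ^ M)%N.
Proof.
rewrite card_family foldrE big_map big_enum /= big_split_ord /=.
congr (_ * _)%N.
  under eq_bigr => i _ do rewrite ltn_ord.
  by rewrite prod_nat_const card_ord cardT size_enum_ord.
under eq_bigr => i _ do rewrite ltnNge leq_addr /=.
by rewrite prod_nat_const card_ord cardC1 card_ord.
Qed.

Lemma avoids_block_le k n M :
  (P (avoids k [set m | (n <= m < n + M)%N]) <= ((a%:R / a.+1%:R) ^+ M)%:E)%E.
Proof.
pose cyl (f : {ffun 'I_(n + M) -> 'I_a.+1}) :=
  cylinder [seq f i | i <- enum 'I_(n + M)].
have cover : avoids k [set m | (n <= m < n + M)%N]
    `<=` \bigcup_(f in [set` enum (words_avoiding k n M)]) cyl f.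
  move=> w avoid; exists [ffun i : 'I_(n + M) => I i w].
    rewrite /= mem_enum; apply/familyP => i; rewrite ffunE unfold_in.
    case: ltnP => // ni; apply/eqP/avoid; rewrite /= ni; exact: ltn_ord.
  move=> m; rewrite size_map size_enum_ord => lt_m.
  rewrite (nth_map (Ordinal lt_m)) ?size_enum_ord // ffunE.
  by rewrite nth_enum_ord.
have := content_sub_fsum P (finite_seq _) (fun f _ => measurable_cylinder _)
  (measurable_avoids k _) cover.
rewrite -fsbig_seq ?enum_uniq // big_enum /=.
under eq_bigr do rewrite cylinder_prob size_map size_enum_ord.
rewrite sumEFin sumr_const card_words_avoiding; congr (_ <= _%:E)%E.
rewrite -[_ *+ (_ * _)]mulr_natr natrM !natrX !expr_div_n !expr1n exprD.
by field; rewrite -!natrX -?natrM !pnatr_eq0 -?lt0n ?expn_gt0.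
Qed.

Lemma avoids_tail_negligible k n :
  P.-negligible (avoids k [set m | (n <= m)%N]).
Proof.
set tail := avoids k _; have measurable_tail : measurable tail.
  exact: measurable_avoids.
apply/negligibleP => //.
have le_block M : fine (P tail) <= (a%:R / a.+1%:R) ^+ M.
  rewrite -lee_fin fineK ?fin_num_measure //.
  apply: le_trans (avoids_block_le k n M); apply: le_measure; rewrite ?inE //.
    exact: measurable_avoids.
  by move=> w avoid m /= /andP[nm _]; exact: avoid.
have ratio_lt1 : `|a%:R / a.+1%:R| < 1 :> R.
  by rewrite ger0_norm ?divr_ge0 // ltr_pdivrMr ?ltr0n // mul1r ltr_nat.
have /cvgr_to_ge/(_ (nearW _ le_block)) := cvg_expr ratio_lt1.
move=> fine_le0; rewrite -[LHS]fineK ?fin_num_measure //; congr (_%:E).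
by apply/eqP; rewrite eq_le fine_le0 fine_ge0.
Qed.

Lemma ae_letter_infinitely_often :
  {ae P, forall w, forall n k, exists2 m, (n <= m)%N & I m w = k}.
Proof.
suff : {ae P, forall w, forall n k : nat,
    exists2 m, (n <= m)%N & I m w = inord k}.
  by apply: filterS => w often n k; have := often n k; rewrite inord_val.
apply: ae_foralln => n; apply: ae_foralln => k.
apply: negligibleS (avoids_tail_negligible (inord k) n) => w /= never m nm Imw.
by apply: never; exists m.
Qed.

End UniformLetters.

Theorem mainTheorem2 (R : realType) (L : 'I_3 -> hline R) (z0 : pt R)
  (d : measure_display) (T : measurableType d) (P : probability T R)
  (I : nat -> T -> 'I_3) :
  (forall i, line_ok (L i)) ->
  inH z0 ->
  (forall i i' : 'I_3, i != i' ->
     cond_disjoint (L i) (L i') z0 \/ cond_angle (L i) (L i') z0) ->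
  (forall m (k : 'I_3), measurable [set w | I m w = k]) ->
  (forall ks : seq 'I_3,
     P [set w | forall m, (m < size ks)%N -> I m w = nth ord0 ks m]
       = ((1 / 3%:R) ^+ size ks)%:E) ->
  {ae P, forall w, ~ eventually_const L (demazure L (I ^~ w))} /\
  (forall w, ~ eventually_const L (demazure L (I ^~ w)) ->
     exists zeta : option R,
       conv_bdry (fun m => act L (demazure L (I ^~ w) m) z0) zeta).
Proof.
move=> okL hz0 chamber measurable_letter cylinder_prob.
split; last by move=> w; exact: demazure_boundary_limit okL hz0 chamber _.
apply: filterS (ae_letter_infinitely_often measurable_letter cylinder_prob).
by move=> w; exact: demazure_not_eventually_const okL hz0 chamber _.
Qed.
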